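(* Let $K,N,M\in\mathbb N$, let $(\mu^{(k)},\nu^{(k)})\in\Delta_N\times\Delta_M$, $k\in\{1,\dots,K\}$, be pairs of marginals, and let $\pi^{(k)}\in\Pi(\mu^{(k)},\nu^{(k)})$ (optimal transport plans) and $f^{(k)}\in\mathbb R^N$ (first optimal potentials), $k\in\{1,\dots,K\}$, be observed with respect to an underlying cost matrix $c\in\mathbb R^{N\times M}$. Let $S_k=\operatorname{supp}\pi^{(k)}$. If $S_1,\dots,S_K$ are connected, then the cost matrix $c$ is identifiable in $\mathrm{SC}_2^{N\times M}$, that is, any two cost matrices consistent with the observed marginals, optimal transport plans and first optimal potentials differ by a matrix of the form $0\oplus b$ with $b\in\mathbb R^M$.
   Context: $\Delta_N=\{x\in\mathbb R^N: x_i\ge 0,\ \sum_i x_i=1\}$. For $\mu\in\Delta_N$, $\nu\in\Delta_M$, $\Pi(\mu,\nu)$ is the set of $N\times M$ matrices with nonnegative entries, row sums $\mu$ and column sums $\nu$. For $\pi\in\Pi(\mu,\nu)$, $\operatorname{supp}\pi=\{(i,j)\in\{1,\dots,N\}\times\{1,\dots,M\}:\pi_{i,j}>0\}$. For $a\in\mathbb R^N,b\in\mathbb R^M$, $a\oplus b$ is the $N\times M$ matrix with entries $a_i+b_j$. For $c\in\mathbb R^{N\times M}$, $\mathcal T_c(\mu,\nu)=\min_{\pi\in\Pi(\mu,\nu)}\langle c,\pi\rangle$ (Frobenius inner product) and $\Phi_c=\{(f,g)\in\mathbb R^N\times\mathbb R^M: f_i+g_j\le c_{i,j}\text{ for all }i,j\}$;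 minimizers $\pi$ are optimal transport plans, and $(f,g)\in\Phi_c$ with $\langle f,\mu\rangle+\langle g,\nu\rangle=\mathcal T_c(\mu,\nu)$ are optimal potentials ($f$ is the first, $g$ the second optimal potential). Observed information: the marginals, the plans $\pi^{(k)}$ and the first potentials $f^{(k)}$ (the second potentials and total costs are not observed). A cost matrix $c$ is consistent if for every $k$ the plan $\pi^{(k)}$ is an optimal transport plan between $\mu^{(k)}$ and $\nu^{(k)}$ with respect to $c$ and there exists $g^{(k)}\in\mathbb R^M$ such that $(f^{(k)},g^{(k)})\in\Phi_c$ are optimal potentials for $(\mu^{(k)},\nu^{(k)})$ with respect to $c$. The underlying $c$ is assumed consistent. $\mathrm{SC}_2^{N\times M}$ is the quotient of $\mathbb R^{N\times M}$ by the subspace of marginal shifts $\{0\oplus b:b\in\mathbb R^M\}$. Connectedness: set $S_{k,\ell}=S_k\cap S_\ell$. For $j\in\{1,\dots,M\}$, $S_k$ and $S_\ell$ are $j$-connected if there exist $q\ge1$ and sequences $r_1,\dots,r_{q-1}\in\{1,\dots,K\}$ (with $r_0=k$, $r_q=\ell$) and $i_1,\dots,i_q\in\{1,\dots,N\}$ such that $(i_v,j)\in S_{r_{v-1},r_v}$ for all $v\in\{1,\dots,q\}$. The supports $S_1,\dots,S_K$ are connected if there exists $h\in\{1,\dots,K\}$ such that for all $(i,j)\in\{1,\dots,N\}\times\{1,\dots,M\}$ there exists $\ell\in\{1,\dots,K\}$ such that $(i,j)\in S_\ell$ and $S_h,S_\ell$ are $j$-connected. *)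

(* Defs.v *)
From HB Require Import structures.
From mathcomp Require Import all_boot all_order all_algebra.
From mathcomp Require Import boolp classical_sets reals.

Set Implicit Arguments.
Unset Strict Implicit.
Unset Printing Implicit Defensive.

Import Order.TTheory GRing.Theory Num.Theory.

Local Open Scope ring_scope.

Definition simplex (R : realType) (n : nat) : set 'rV[R]_n :=
  [set x : 'rV[R]_n | (forall i, 0 <= x 0 i) /\ \sum_i x 0 i = 1]%classic.

Definition couplings (R : realType) (N M : nat)
    (mu : 'rV[R]_N) (nu : 'rV[R]_M) : set 'M[R]_(N, M) :=
  [set p : 'M[R]_(N, M) |
    [/\ forall i j, 0 <= p i j,
        forall i, \sum_j p i j = mu 0 i &
        forall j, \sum_i p i j = nu 0 j]]%classic.

Definition supp (R : realType) (N M : nat) (p : 'M[R]_(N, M)) :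
    {set 'I_N * 'I_M} :=
  [set ij : 'I_N * 'I_M | 0 < p ij.1 ij.2]%SET.

Definition oplus (R : realType) (N M : nat) (a : 'rV[R]_N) (b : 'rV[R]_M) :
    'M[R]_(N, M) :=
  \matrix_(i, j) (a 0 i + b 0 j).

Definition dotv (R : realType) (n : nat) (x y : 'rV[R]_n) : R :=
  \sum_i x 0 i * y 0 i.

Definition frobenius (R : realType) (N M : nat) (c p : 'M[R]_(N, M)) : R :=
  \sum_i \sum_j c i j * p i j.

Definition optimal_plan (R : realType) (N M : nat) (c : 'M[R]_(N, M))
    (mu : 'rV[R]_N) (nu : 'rV[R]_M) (p : 'M[R]_(N, M)) : Prop :=
  couplings mu nu p /\
  forall p', couplings mu nu p' -> frobenius c p <= frobenius c p'.

(* An infimum, equal to the minimum as soon as an optimal plan exists: see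
   [optimal_plan_cost]. *)
Definition transport_cost (R : realType) (N M : nat) (c : 'M[R]_(N, M))
    (mu : 'rV[R]_N) (nu : 'rV[R]_M) : R :=
  inf [set frobenius c p | p in couplings mu nu]%classic.

Lemma optimal_plan_cost (R : realType) (N M : nat) (c : 'M[R]_(N, M))
    (mu : 'rV[R]_N) (nu : 'rV[R]_M) (p : 'M[R]_(N, M)) :
  optimal_plan c mu nu p -> transport_cost c mu nu = frobenius c p.
Proof.
move=> [pmunu p_min]; apply/eqP; rewrite eq_le; apply/andP; split.
  apply: ge_inf; last by exists p.
  by exists (frobenius c p) => _ [p' /p_min p'_ge <-].
apply: lb_le_inf; first by exists (frobenius c p), p.
by move=> _ [p' /p_min p'_ge <-].
Qed.

Definition dual_feasible (R : realType) (N M : nat) (c : 'M[R]_(N, M)) :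
    set ('rV[R]_N * 'rV[R]_M) :=
  [set fg : 'rV[R]_N * 'rV[R]_M |
    forall i j, fg.1 0 i + fg.2 0 j <= c i j]%classic.

Definition optimal_potentials (R : realType) (N M : nat) (c : 'M[R]_(N, M))
    (mu : 'rV[R]_N) (nu : 'rV[R]_M) (f : 'rV[R]_N) (g : 'rV[R]_M) : Prop :=
  dual_feasible c (f, g) /\ dotv f mu + dotv g nu = transport_cost c mu nu.

Definition consistent (R : realType) (K N M : nat)
    (mu : 'I_K -> 'rV[R]_N) (nu : 'I_K -> 'rV[R]_M)
    (pi : 'I_K -> 'M[R]_(N, M)) (f : 'I_K -> 'rV[R]_N) : set 'M[R]_(N, M) :=
  [set c : 'M[R]_(N, M) | forall k, optimal_plan c (mu k) (nu k) (pi k) /\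
    exists g : 'rV[R]_M, optimal_potentials c (mu k) (nu k) (f k) g]%classic.

(* Only the values r 0, ..., r q and i 1, ..., i q matter. *)
Definition j_connected (K N M : nat) (S : 'I_K -> {set 'I_N * 'I_M})
    (j : 'I_M) (k l : 'I_K) : Prop :=
  exists (q : nat) (r : nat -> 'I_K) (i : nat -> 'I_N),
    [/\ (1 <= q)%N, r 0%N = k, r q = l &
        forall v, (1 <= v <= q)%N -> (i v, j) \in S (r v.-1) :&: S (r v)].

Definition connected (K N M : nat) (S : 'I_K -> {set 'I_N * 'I_M}) : Prop :=
  exists h : 'I_K, forall (i : 'I_N) (j : 'I_M),
    exists l : 'I_K, (i, j) \in S l /\ j_connected S j h l.

Definition marginal_shifts2 (R : realType) (N M : nat) : set 'M[R]_(N, M) :=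
  [set oplus 0 b | b in [set: 'rV[R]_M]]%classic.

(* The matrices in C have a single class in the quotient of the matrix space
   by the subspace W. *)
Definition identifiable_mod (R : realType) (N M : nat)
    (W C : set 'M[R]_(N, M)) : Prop :=
  forall c1 c2, C c1 -> C c2 -> W (c1 - c2).

(* Main.v *)
Require Import Defs.
From mathcomp Require Import all_boot all_order all_algebra.
From mathcomp Require Import boolp classical_sets reals.

(** By complementary slackness, optimal potentials are tight on the support of
    an optimal plan: a consistent [c] satisfies [c i j = f_k i + g_k j] for
    [(i, j)] in the [k]-th support, with second potentials [g_k] depending on
    [c] ([consistent_tight_potentials]).  Given two consistent costs with
    second potentials [g1] and [g2], the first potentials cancel, so
    [c1 i j - c2 i j = g1_k j - g2_k j] there.  The right-hand side does not
    mention [i] and the left-hand side does not mention [k]: two plans sharing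
    an entry of column [j] have the same discrepancy [g1_k j - g2_k j], hence
    so do all plans that are [j]-connected to each other
    ([j_connected_invariant]).  Connectedness propagates the discrepancy of the
    single plan [h] to every entry, so [c1 - c2] is constant along each
    column, with value [g1_h - g2_h]. *)

Set Implicit Arguments.
Unset Strict Implicit.
Unset Printing Implicit Defensive.

Import Order.TTheory GRing.Theory Num.Theory.

Local Open Scope ring_scope.

Lemma frobenius_oplus (R : realType) (N M : nat)
    (mu : 'rV[R]_N) (nu : 'rV[R]_M) (p : 'M[R]_(N, M))
    (f : 'rV[R]_N) (g : 'rV[R]_M) :
  couplings mu nu p -> frobenius (oplus f g) p = dotv f mu + dotv g nu.
Proof.
move=> [_ p_row p_col].
have -> : frobenius (oplus f g) p =
    \sum_i \sum_j f 0 i * p i j + \sum_i \sum_j g 0 j * p i j.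
  rewrite -big_split; apply: eq_bigr => i _.
  by rewrite -big_split; apply: eq_bigr => j _; rewrite mxE mulrDl.
rewrite [X in _ + X]exchange_big; congr (_ + _); apply: eq_bigr => i _.
  by rewrite -mulr_sumr p_row.
by rewrite -mulr_sumr p_col.
Qed.

(** Complementary slackness: the slacks [c i j - (f i + g j)], weighted by the
    plan, are nonnegative, and they add up to the duality gap, which is zero. *)
Lemma optimal_potentials_tight (R : realType) (N M : nat) (c : 'M[R]_(N, M))
    (mu : 'rV[R]_N) (nu : 'rV[R]_M) (p : 'M[R]_(N, M))
    (f : 'rV[R]_N) (g : 'rV[R]_M) (i : 'I_N) (j : 'I_M) :
  optimal_plan c mu nu p -> optimal_potentials c mu nu f g ->
  (i, j) \in supp p -> c i j = f 0 i + g 0 j.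
Proof.
move=> p_opt [fg_le]; rewrite (optimal_plan_cost p_opt).
have [pmunu _] := p_opt; have [p_ge0 _ _] := pmunu.
rewrite -(frobenius_oplus f g pmunu) inE /= => gap0 pij_gt0.
pose slack i j := (c i j - (f 0 i + g 0 j)) * p i j.
have slack_ge0 i' j' : 0 <= slack i' j'.
  by rewrite mulr_ge0 // subr_ge0; apply: fg_le.
have slack_sum : \sum_i \sum_j slack i j = 0.
  rewrite -[RHS](subrr (frobenius c p)) -{2}gap0.
  rewrite -sumrB; apply: eq_bigr => i' _.
  by rewrite -sumrB; apply: eq_bigr => j' _; rewrite /slack mxE mulrBl.
have row_sum0 : \sum_j slack i j = 0.
  by apply: (psumr_eq0P _ slack_sum) => // i' _; apply: sumr_ge0.
have /eqP : slack i j = 0 by apply: (psumr_eq0P _ row_sum0).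
by rewrite mulf_eq0 (gt_eqF pij_gt0) orbF subr_eq0 => /eqP.
Qed.

(** Consistency supplies a second potential for each [k] separately; choosing
    them as one family makes the discrepancy [g1 k - g2 k] a function of [k],
    to which [j_connected_invariant] applies. *)
Lemma consistent_tight_potentials (R : realType) (K N M : nat)
    (mu : 'I_K -> 'rV[R]_N) (nu : 'I_K -> 'rV[R]_M)
    (pi : 'I_K -> 'M[R]_(N, M)) (f : 'I_K -> 'rV[R]_N) (c : 'M[R]_(N, M)) :
  consistent mu nu pi f c ->
  exists g : 'I_K -> 'rV[R]_M, forall k i j,
    (i, j) \in supp (pi k) -> c i j = f k 0 i + g k 0 j.
Proof.
move=> c_cons.
have [g g_opt] := choice (fun k => proj2 (c_cons k)).
exists g => k i j; apply: optimal_potentials_tight (g_opt k).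
exact: (proj1 (c_cons k)).
Qed.

(** The data [F] is constant along the chain of plans given by
    [j]-connectedness, each link of which is an entry of column [j] shared by
    two consecutive supports. *)
Lemma j_connected_invariant (T : Type) (K N M : nat)
    (S : 'I_K -> {set 'I_N * 'I_M}) (j : 'I_M) (F : 'I_K -> T) (k l : 'I_K) :
  (forall k' l' i, (i, j) \in S k' :&: S l' -> F k' = F l') ->
  j_connected S j k l -> F k = F l.
Proof.
move=> F_eq [q [r [i [_ <- <- r_step]]]].
have: (q <= q)%N by [].
elim: {-2}q => [//|v IHv] v_lt_q.
by rewrite (IHv (ltnW v_lt_q)); apply: F_eq (r_step v.+1 v_lt_q).
Qed.

Theorem theorem2p34 (R : realType) (K N M : nat)
    (mu : 'I_K -> 'rV[R]_N) (nu : 'I_K -> 'rV[R]_M)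
    (pi : 'I_K -> 'M[R]_(N, M)) (f : 'I_K -> 'rV[R]_N) (c : 'M[R]_(N, M))
    (hmu : forall k, simplex (mu k)) (hnu : forall k, simplex (nu k))
    (hpi : forall k, couplings (mu k) (nu k) (pi k))
    (hc : consistent mu nu pi f c)
    (hS : connected (fun k => supp (pi k))) :
  identifiable_mod (@marginal_shifts2 R N M) (consistent mu nu pi f).
Proof.
move=> c1 c2 /consistent_tight_potentials[g1 tight1].
move=> /consistent_tight_potentials[g2 tight2].
have diff_tight k i j : (i, j) \in supp (pi k) ->
    c1 i j - c2 i j = (g1 k - g2 k) 0 j.
  move=> ij_k; rewrite (tight1 k) // (tight2 k) // !mxE.
  by rewrite opprD addrACA subrr add0r.
have [h h_conn] := hS.
exists (g1 h - g2 h) => //; apply/matrixP => i j.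
have [l [ij_l hl_conn]] := h_conn i j.
have -> : (c1 - c2) i j = c1 i j - c2 i j by rewrite !mxE.
rewrite mxE [X in X + _]mxE add0r (diff_tight l) //.
apply: (j_connected_invariant (F := fun k => (g1 k - g2 k) 0 j) _ hl_conn).
move=> k' l' i'; rewrite finset.in_setI => /andP[i'j_k' i'j_l'].
(* The shared entry gives both discrepancies the value of [c1 - c2] there. *)
by rewrite -(diff_tight k' i') // -(diff_tight l' i').
Qed.
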